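(* Let $(\mathcal{A},\cdot,\alpha,\Psi)$ be an $\alpha$-pseudo-Euclidean Hom-alternative superalgebra and let $\mathfrak{D}:\mathcal{A}\to\mathcal{A}$ be an even antisymmetric superderivation. Then $(\mathcal{A},\cdot,\alpha,\omega)$ is a symplectic Hom-alternative superalgebra, where $$\omega(x,y)=\Psi(\mathfrak{D}(x),y),\qquad x,y\in\mathcal{H}(\mathcal{A}).$$
   Context: $\mathbb{K}$ is an algebraically closed field of characteristic $0$; all vector spaces are finite-dimensional over $\mathbb{K}$. For a $\mathbb{Z}_2$-graded vector space $\mathcal{A}=\mathcal{A}_0\oplus\mathcal{A}_1$, $\mathcal{H}(\mathcal{A})$ denotes the set of homogeneous elements and $|x|$ the degree of $x\in\mathcal{H}(\mathcal{A})$. A linear or bilinear map is even if it preserves the grading; a bilinear form is even if it vanishes on $\mathcal{A}_0\times\mathcal{A}_1$ and $\mathcal{A}_1\times\mathcal{A}_0$. A Hom-superalgebra $(\mathcal{A},\cdot,\alpha)$ is a $\mathbb{Z}_2$-graded vector space with an even bilinear map $\cdot:\mathcal{A}\times\mathcal{A}\to\mathcal{A}$ and an even linear map $\alpha:\mathcal{A}\to\mathcal{A}$. All Hom-superalgebras are assumed multiplicative: $\alpha(x\cdot y)=\alpha(x)\cdot\alpha(y)$. The Hom-associator is $as_{\mathcal{A}}(x,y,z)=(x\cdot y)\cdot\alpha(z)-\alpha(x)\cdot(y\cdot z)$. A Hom-superalgebra is Hom-alternative if for all $x,y,z\in\mathcal{H}(\mathcal{A})$: $as_{\mathcal{A}}(x,y,z)+(-1)^{|x||y|}as_{\mathcal{A}}(y,x,z)=0$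 and $as_{\mathcal{A}}(x,y,z)+(-1)^{|y||z|}as_{\mathcal{A}}(x,z,y)=0$. An $\alpha$-pseudo-Euclidean Hom-alternative superalgebra $(\mathcal{A},\cdot,\alpha,\Psi)$ is a Hom-alternative superalgebra with an even non-degenerate bilinear form $\Psi$ that is supersymmetric ($\Psi(x,y)=(-1)^{|x||y|}\Psi(y,x)$), $\alpha$-invariant ($\Psi(x\cdot y,\alpha(z))=\Psi(\alpha(x),y\cdot z)$) and satisfies $\Psi(\alpha(x),\alpha(y))=\Psi(x,y)$, for all $x,y,z\in\mathcal{H}(\mathcal{A})$. An even antisymmetric superderivation of such an $\mathcal{A}$ is an even linear map $\mathfrak{D}:\mathcal{A}\to\mathcal{A}$ such that, for all $x,y\in\mathcal{H}(\mathcal{A})$, $\mathfrak{D}(x\cdot y)=\mathfrak{D}(x)\cdot y+x\cdot\mathfrak{D}(y)$, $\alpha\mathfrak{D}=\mathfrak{D}\alpha$, and $\Psi(\mathfrak{D}(x),y)+\Psi(x,\mathfrak{D}(y))=0$. A symplectic Hom-alternative superalgebra $(\mathcal{A},\cdot,\alpha,\omega)$ is a Hom-alternative superalgebra with a super-skew-symmetric ($\omega(x,y)=-(-1)^{|x||y|}\omega(y,x)$), non-degenerate, even bilinear form $\omega$ such that for all $x,y,z\in\mathcal{H}(\mathcal{A})$ $$(-1)^{|x||z|}\omega(\alpha(x),y\cdot z)+(-1)^{|y||x|}\omega(\alpha(y),z\cdot x)+(-1)^{|z||y|}\omega(\alpha(z),x\cdot y)=0.$$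
   Formalization: The superderivation D is additionally assumed invertible: for D = 0 the form ω is zero, hence degenerate on a nonzero algebra; since Ψ is non-degenerate, ω is non-degenerate exactly when D is invertible. *)

(* Defs.v *)
From HB Require Import structures.
From mathcomp Require Import all_boot all_order all_algebra.

Set Implicit Arguments.
Unset Strict Implicit.
Unset Printing Implicit Defensive.

Import GRing.Theory.
Local Open Scope ring_scope.

Section HomSuperalgebras.

Variables (K : fieldType) (A : vectType K).

(* Z_2 is encoded as bool: degree 0 is false, degree 1 is true, the sum of two
   degrees is (+) and their product is &&. The homogeneous elements of degree i
   are those of G i, so that a quantification over homogeneous elements and
   their degrees reads: forall i x, x \in G i -> ... *)
Variable G : bool -> {vspace A}.

Definition grading : Prop :=
  directv (G false + G true) /\ (G false + G true = fullv)%VS.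

Definition sgn (i j : bool) : K := (-1) ^+ (i && j).

Definition even_endo (f : 'End(A)) : Prop :=
  forall i x, x \in G i -> f x \in G i.

Definition even_mul (mul : A -> A -> A) : Prop :=
  forall i j x y, x \in G i -> y \in G j -> mul x y \in G (i (+) j).

Definition even_form (f : A -> A -> K) : Prop :=
  forall i j x y, x \in G i -> y \in G j -> i != j -> f x y = 0.

Definition nondegenerate_form (f : A -> A -> K) : Prop :=
  (forall x, (forall y, f x y = 0) -> x = 0) /\
  (forall y, (forall x, f x y = 0) -> y = 0).

Definition supersymmetric (f : A -> A -> K) : Prop :=
  forall i j x y, x \in G i -> y \in G j -> f x y = sgn i j * f y x.

Definition super_skew_symmetric (f : A -> A -> K) : Prop :=
  forall i j x y, x \in G i -> y \in G j -> f x y = - (sgn i j * f y x).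

Variables (mul : {bilinear A -> A -> A}) (alpha : 'End(A)).

Record hom_superalgebra : Prop := HomSuperalgebra {
  hsa_grading : grading;
  hsa_mul_even : even_mul mul;
  hsa_alpha_even : even_endo alpha;
  hsa_multiplicative : forall x y, alpha (mul x y) = mul (alpha x) (alpha y)
}.

Definition hom_associator (x y z : A) : A :=
  mul (mul x y) (alpha z) - mul (alpha x) (mul y z).

Record hom_alternative_superalgebra : Prop := HomAlternativeSuperalgebra {
  hasa_superalgebra : hom_superalgebra;
  hasa_left : forall i j k x y z, x \in G i -> y \in G j -> z \in G k ->
    hom_associator x y z + sgn i j *: hom_associator y x z = 0;
  hasa_right : forall i j k x y z, x \in G i -> y \in G j -> z \in G k ->
    hom_associator x y z + sgn j k *: hom_associator x z y = 0
}.

Record alpha_pseudo_euclidean (Psi : {biscalar A}) : Prop :=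
  AlphaPseudoEuclidean {
  ape_alternative : hom_alternative_superalgebra;
  ape_even : even_form Psi;
  ape_nondegenerate : nondegenerate_form Psi;
  ape_supersymmetric : supersymmetric Psi;
  ape_invariant : forall i j k x y z, x \in G i -> y \in G j -> z \in G k ->
    Psi (mul x y) (alpha z) = Psi (alpha x) (mul y z);
  ape_isometry : forall i j x y, x \in G i -> y \in G j ->
    Psi (alpha x) (alpha y) = Psi x y
}.

Record even_antisym_superderivation (Psi : {biscalar A}) (D : 'End(A)) : Prop :=
  EvenAntisymSuperderivation {
  esd_even : even_endo D;
  esd_leibniz : forall i j x y, x \in G i -> y \in G j ->
    D (mul x y) = mul (D x) y + mul x (D y);
  esd_commute : (alpha \o D = D \o alpha)%VF;
  esd_antisym : forall i j x y, x \in G i -> y \in G j ->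
    Psi (D x) y + Psi x (D y) = 0
}.

Record symplectic_hom_alternative (omega : {biscalar A}) : Prop :=
  SymplecticHomAlternative {
  sha_alternative : hom_alternative_superalgebra;
  sha_skew : super_skew_symmetric omega;
  sha_nondegenerate : nondegenerate_form omega;
  sha_even : even_form omega;
  sha_closed : forall i j k x y z, x \in G i -> y \in G j -> z \in G k ->
    sgn i k * omega (alpha x) (mul y z) + sgn j i * omega (alpha y) (mul z x)
      + sgn k j * omega (alpha z) (mul x y) = 0
}.

End HomSuperalgebras.

Section SuperderivationForm.

Variables (K : fieldType) (A : vectType K) (Psi : {biscalar A}) (D : 'End(A)).

Definition superderivation_form (x y : A) : K := Psi (D x) y.

Fact superderivation_form_bilinear :
  bilinear_for ( *%R : GRing.Scale.law K K) ( *%R : GRing.Scale.law K K)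
    superderivation_form.
Proof.
split=> [y a u v|x a u v]; rewrite /superderivation_form.
  by rewrite linearP linearPl.
by rewrite linearPr.
Qed.

HB.instance Definition _ :=
  bilinear_isBilinear.Build K A A K *%R *%R superderivation_form
    superderivation_form_bilinear.

End SuperderivationForm.

(* Main.v *)
(* Invariance together with supersymmetry moves the three cyclic terms to
   (-1)^(|x||z|) times Psi(D(x)y, alpha z), Psi(x D(y), alpha z) and
   - Psi(D(xy), alpha z), whose sum vanishes by the Leibniz rule. Invertibility
   of D is what carries the non-degeneracy of Psi over to omega. *)
Require Import Defs.
From mathcomp Require Import all_boot all_order all_algebra.
From mathcomp Require Import ring.
Import GRing.Theory.
Local Open Scope ring_scope.

Theorem lemma3p15 (K : closedFieldType) (K_char0 : [pchar K] =i pred0)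
    (A : vectType K) (G : bool -> {vspace A})
    (mul : {bilinear A -> A -> A}) (alpha : 'End(A)) (Psi : {biscalar A})
    (A_pseudo_euclidean : alpha_pseudo_euclidean G mul alpha Psi)
    (D : 'End(A))
    (D_superderivation : even_antisym_superderivation G mul alpha Psi D)
    (D_invertible : bijective D) :
  symplectic_hom_alternative G mul alpha (superderivation_form Psi D).
Proof.
case: A_pseudo_euclidean => altA evPsi [ndl ndr] symPsi invPsi _.
case: D_superderivation => evD leibD commD antiD.
have [[_ evM eva _] _ _] := altA.
have alphaD x : D (alpha x) = alpha (D x).
  by have := congr1 (fun f : 'End(A) => f x) commD; rewrite !lfunE /= => ->.
split=> //.
- move=> i j x y Gx Gy; rewrite /= /superderivation_form.
  (* Supersymmetry turns the right side into [- Psi x (D y)], leaving the antisymmetry of [D]. *)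
  rewrite -(symPsi i j x (D y) Gx (evD _ _ Gy)).
  by apply/eqP; rewrite -addr_eq0 (antiD i j).
- have [E DK EK] := D_invertible; split.
    by move=> x /ndl Dx0; apply: (can_inj DK); rewrite Dx0 linear0.
  (* Since each [x] is [D (E x)], [y] is tested against every vector. *)
  by move=> y Dy0; apply: ndr => x; rewrite -(EK x); apply: Dy0.
- by move=> i j x y Gx Gy; apply: evPsi; first exact: evD.
- move=> i j k x y z Gx Gy Gz; rewrite /= /superderivation_form.
  have GDx := evD _ _ Gx; have GDy := evD _ _ Gy.
  have Gaz := eva _ _ Gz.
  have Gxy := evM _ _ _ _ Gx Gy.
  rewrite !alphaD -(invPsi _ _ _ _ _ _ GDx Gy Gz).
  (* Two swaps around one use of invariance bring [alpha z] to the right. *)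
  rewrite (symPsi _ _ _ _ (eva _ _ GDy) (evM _ _ _ _ Gz Gx)).
  rewrite (invPsi _ _ _ _ _ _ Gz Gx GDy).
  rewrite (symPsi _ _ _ _ Gaz (evM _ _ _ _ Gx GDy)).
  have /eqP := antiD _ _ _ _ Gaz Gxy; rewrite addr_eq0 alphaD => /eqP ->.
  rewrite (symPsi _ _ _ _ Gaz (evD _ _ Gxy)).
  rewrite (leibD _ _ _ _ Gx Gy) linearDl /sgn.
  (* Modulo 2, ji + j(k+i) + k(i+j) and kj + k(i+j) both equal ik, so a common sign factors out. *)
  by case: i j k {Gx Gy Gz GDx GDy Gaz Gxy} => [] [] [] /=; ring.
Qed.
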